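(* Let $X$ be a finite set with $|X|\ge 2$ and let $G\le\mathrm{Aut}(X^* )$ be a bounded automata group. If $G$ contains an odometer, then $G$ is either virtually abelian or not elementary amenable.
   Context: For a finite set $X$ with $|X|\ge 2$, $X^*$ is the free monoid on $X$, viewed as a rooted tree (its Cayley graph), and $X^k$ is the set of words of length $k$. $\mathrm{Aut}(X^* )$ is the group of bijections $g$ of $X^*$ such that $a$ is a prefix of $b$ if and only if $g(a)$ is a prefix of $g(b)$. For $g\in\mathrm{Aut}(X^* )$ and $w\in X^*$, the section $g_w\in \mathrm{Aut}(X^* )$ is the automorphism determined by $g(wu)=g(w)g_w(u)$ for all $u\in X^*$. A group $G\le \mathrm{Aut}(X^* )$ is self-similar if $g_w\in G$ for all $g\in G$, $w\in X^*$. An element $g$ is finite state if $\{g_v\mid v\in X^*\}$ is finite, and bounded if there is $N\ge 0$ such that $|\{v\in X^n\mid g_v\ne 1\}|\le N$ for all $n\ge 1$. $G$ is a bounded automata group if it is finitely generated, self-similar, and every element of $G$ is bounded and finite state. An element $d\in\mathrm{Aut}(X^* )$ is an odometer if $\langle d\rangle$ acts transitively on $X$ and $d_x\in\{1,d\}$ for all $x\in X$ with exactly one $x\in X$ such that $d_x=d$. The class of elementary amenable groups is the smallest class of groups containing all finite groups and all abelian groups and closed under taking subgroups, quotients, group extensions, and direct limits. *)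

(* Defs.v *)
From HB Require Import structures.
From mathcomp Require Import all_boot all_order.
From mathcomp Require Import boolp classical_sets functions cardinality.

Set Implicit Arguments.
Unset Strict Implicit.
Unset Printing Implicit Defensive.

Local Open Scope group_scope.

Section Subgroup.
Variables (T : groupType) (S : groupClosed T).

Record subgroup := Subgroup { subgroup_val :> T; _ : subgroup_val \in S }.

HB.instance Definition _ := [isSub for subgroup_val].
HB.instance Definition _ := [Choice of subgroup by <:].

Lemma subgroup_closed : group_closed S.
Proof. by split=> [|x y xS yS]; rewrite ?gpred1 ?gpredM ?gpredVr. Qed.

HB.instance Definition _ :=
  SubChoice_isSubGroup.Build T (mem S) subgroup subgroup_closed.

End Subgroup.

Definition finitely_generated (T : groupType) : Prop :=
  exists s : seq T, forall H : groupClosed T,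
    {subset s <= H} -> forall x, x \in H.

Definition virtually_abelian (T : groupType) : Prop :=
  exists H : groupClosed T,
    {in H &, forall x y, commute x y} /\
    exists s : seq T, forall g : T,
      exists2 r, r \in s & exists2 h, h \in H & g = r * h.

(* [L] is, via the maps [phi i], the quotient of the disjoint union of the
   [D i] by eventual equality along the directed system [(D, f)]. *)
Record is_direct_limit (d : Order.disp_t) (I : preorderType d)
    (D : I -> groupType)
    (f : forall i j, (i <= j)%O -> {multiplicative D i -> D j})
    (L : groupType) (phi : forall i, {multiplicative D i -> L}) : Prop := {
  dl_inhabited : inhabited I;
  dl_directed : forall i j : I, exists k, (i <= k)%O /\ (j <= k)%O;
  dl_id : forall i (ii : (i <= i)%O) x, f i i ii x = x;
  dl_comp : forall i j k
      (ij : (i <= j)%O) (jk : (j <= k)%O) (ik : (i <= k)%O) x,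
    f i k ik x = f j k jk (f i j ij x);
  dl_surj : forall y : L, exists i x, phi i x = y;
  dl_eq : forall i j x y, phi i x = phi j y <->
    exists k (ik : (i <= k)%O) (jk : (j <= k)%O), f i k ik x = f j k jk y }.

(* Subgroups and quotients are taken up to isomorphism, as sources of
   injective and targets of surjective homomorphisms. *)
Inductive elementary_amenable : groupType -> Prop :=
| ea_finite (T : groupType) :
    finite_set [set: T]%classic -> elementary_amenable T
| ea_abelian (T : groupType) :
    (forall x y : T, commute x y) -> elementary_amenable T
| ea_subgroup (H T : groupType) (i : {multiplicative H -> T}) :
    injective i -> elementary_amenable T -> elementary_amenable H
| ea_quotient (T Q : groupType) (p : {multiplicative T -> Q}) :
    (forall y, exists x, p x = y) ->
    elementary_amenable T -> elementary_amenable Q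
| ea_extension (N T Q : groupType)
    (i : {multiplicative N -> T}) (p : {multiplicative T -> Q}) :
    injective i -> (forall y, exists x, p x = y) ->
    (forall x, p x = 1 <-> exists n, i n = x) ->
    elementary_amenable N -> elementary_amenable Q -> elementary_amenable T
| ea_direct_limit (d : Order.disp_t) (I : preorderType d) (D : I -> groupType)
    (f : forall i j, (i <= j)%O -> {multiplicative D i -> D j})
    (L : groupType) (phi : forall i, {multiplicative D i -> L}) :
    is_direct_limit f phi ->
    (forall i, elementary_amenable (D i)) -> elementary_amenable L.

(* The words over [X], i.e. the vertices of the tree X^*, are [seq X]. *)
Record tree_aut (X : finType) := TreeAut {
  tree_aut_fun :> seq X -> seq X;
  tree_aut_bij : bijective tree_aut_fun;
  tree_aut_prefix : forall a b,
    prefix a b <-> prefix (tree_aut_fun a) (tree_aut_fun b) }.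

HB.instance Definition _ (X : finType) := gen_eqMixin (tree_aut X).
HB.instance Definition _ (X : finType) := gen_choiceMixin (tree_aut X).

Section TreeAutGroup.
Variable X : finType.
Implicit Types (g h : tree_aut X) (u v w : seq X).

Lemma tree_autP g h : g =1 h -> g = h.
Proof.
case: g h => [g gb gp] [h hb hp] /= /funext gh; rewrite gh in gb gp *.
by congr TreeAut; exact: Prop_irrelevance.
Qed.

Lemma tree_aut_inj g : injective g.
Proof. exact/bij_inj/tree_aut_bij. Qed.

Lemma tree_aut_surj g w : exists v, g v == w.
Proof. by case: (tree_aut_bij g) => g' _ gK; exists (g' w); rewrite gK. Qed.

Definition tree_id : tree_aut X.
Proof. by exists id; [exists id | ]. Defined.

Definition tree_comp g h : tree_aut X.
Proof.
exists (g \o h); first exact: bij_comp (tree_aut_bij g) (tree_aut_bij h).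
by move=> a b; exact: iff_trans (tree_aut_prefix h a b) (tree_aut_prefix g _ _).
Defined.

Definition tree_inv_fun g w : seq X := xchoose (tree_aut_surj g w).

Lemma tree_inv_funK g : cancel (tree_inv_fun g) g.
Proof. by move=> w; exact/eqP/(xchooseP (tree_aut_surj g w)). Qed.

Lemma tree_fun_invK g : cancel g (tree_inv_fun g).
Proof. by move=> w; apply: (@tree_aut_inj g); rewrite tree_inv_funK. Qed.

Definition tree_inv g : tree_aut X.
Proof.
exists (tree_inv_fun g).
  by exists g; [exact: tree_inv_funK | exact: tree_fun_invK].
move=> a b; have := tree_aut_prefix g (tree_inv_fun g a) (tree_inv_fun g b).
by rewrite !tree_inv_funK => -[? ?]; split.
Defined.

Lemma tree_compA : associative tree_comp.
Proof. by move=> g h k; exact: tree_autP. Qed.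
Lemma tree_comp1g : left_id tree_id tree_comp.
Proof. by move=> g; exact: tree_autP. Qed.
Lemma tree_compg1 : right_id tree_id tree_comp.
Proof. by move=> g; exact: tree_autP. Qed.
Lemma tree_compVg : left_inverse tree_id tree_inv tree_comp.
Proof. by move=> g; apply: tree_autP => w /=; rewrite tree_fun_invK. Qed.
Lemma tree_compgV : right_inverse tree_id tree_inv tree_comp.
Proof. by move=> g; apply: tree_autP => w /=; rewrite tree_inv_funK. Qed.

HB.instance Definition _ := isGroup.Build (tree_aut X)
  tree_compA tree_comp1g tree_compg1 tree_compVg tree_compgV.

Lemma tree_aut1E w : (1 : tree_aut X) w = w. Proof. by []. Qed.
Lemma tree_autME g h w : (g * h) w = g (h w). Proof. by []. Qed.

Lemma size_tree_aut_le g w : size w <= size (g w).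
Proof.
pose s := [seq g (take i w) | i <- iota 0 (size w).+1].
pose t := [seq take i (g w) | i <- iota 0 (size (g w)).+1].
have us : uniq s.
  rewrite map_inj_in_uniq ?iota_uniq// => i j.
  rewrite !mem_iota !add0n !ltnS !leq0n /= => iw jw /tree_aut_inj.
  by move=> /(congr1 size); rewrite !size_takel.
have st : {subset s <= t}.
  move=> _ /mapP[i _ ->]; apply/mapP.
  have : prefix (g (take i w)) (g w)
  by apply: (iffLR (tree_aut_prefix g _ _)); exact: prefix_take.
  move=> /[dup] /size_prefix le /prefixP[r wr].
  exists (size (g (take i w))); first by rewrite mem_iota add0n.
  by rewrite wr take_size_cat.
by have := uniq_leq_size us st; rewrite !size_map !size_iota ltnS.
Qed.

Lemma size_tree_aut g w : size (g w) = size w.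
Proof.
apply/eqP; rewrite eqn_leq size_tree_aut_le andbT.
by have := size_tree_aut_le (tree_inv g) (g w); rewrite /= tree_fun_invK.
Qed.

Definition section_fun g w u : seq X := drop (size w) (g (w ++ u)).

Lemma section_funE g w u : g (w ++ u) = g w ++ section_fun g w u.
Proof.
have : prefix (g w) (g (w ++ u))
  by apply: (iffLR (tree_aut_prefix g _ _)); exact: prefix_prefix.
by case/prefixP => r e; rewrite /section_fun e drop_size_cat ?size_tree_aut.
Qed.

Definition section g w : tree_aut X.
Proof.
exists (section_fun g w).
  exists (section_fun (tree_inv g) (g w)) => u.
    rewrite {1}/section_fun -section_funE /= tree_fun_invK.
    by rewrite drop_size_cat// size_tree_aut.
  have := section_funE (tree_inv g) (g w) u; rewrite /= tree_fun_invK => e.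
  by rewrite {1}/section_fun -e tree_inv_funK drop_size_cat// size_tree_aut.
move=> a b; have := tree_aut_prefix g (w ++ a) (w ++ b).
by rewrite !section_funE !prefix_catr// !eqxx.
Defined.

(* This determines [section g w], see [section_unique]. *)
Lemma sectionE g w u : g (w ++ u) = g w ++ section g w u.
Proof. exact: section_funE. Qed.

Lemma section_unique g w h :
  (forall u, g (w ++ u) = g w ++ h u) -> h = section g w.
Proof.
move=> gE; apply: tree_autP => u /=.
by rewrite /section_fun gE drop_size_cat// size_tree_aut.
Qed.

Definition finite_state g : Prop := finite_set (range (section g))%classic.

Definition bounded g : Prop :=
  exists N, forall n, 0 < n -> #|[pred v : n.-tuple X | section g v != 1]| <= N.

Definition self_similar (G : groupClosed (tree_aut X)) : Prop :=
  forall g w, g \in G -> section g w \in G.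

Definition bounded_automata_group (G : groupClosed (tree_aut X)) : Prop :=
  [/\ finitely_generated (subgroup G), self_similar G
    & forall g, g \in G -> bounded g /\ finite_state g].

(* A letter is identified with the corresponding word of length 1. *)
Definition odometer g : Prop :=
  [/\ forall x y : X, exists n : nat,
        (g ^+ n) [:: x] = [:: y] \/ (g ^- n) [:: x] = [:: y],
      forall x : X, section g [:: x] = 1 \/ section g [:: x] = g
    & exists! x : X, section g [:: x] = g].

End TreeAutGroup.

(* Main.v *)
Require Import Defs.
From mathcomp Require Import all_boot all_order.
From HB Require Import structures.
From mathcomp Require Import boolp classical_sets cardinality.

Set Implicit Arguments.
Unset Strict Implicit.
Unset Printing Implicit Defensive.

Local Open Scope group_scope.

(** Let [q = #|X|] and let [d] be the odometer of [G].  The power [d ^+ (q ^ n)]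
    fixes the words of length [n] and has section [d] at each of them, [d] is
    transitive on every level, and so the centraliser of [d] is abelian.

    If the sections at some level of every element of [G] commute with [d],
    the stabiliser of that level embeds in a power of this centraliser, and [G]
    is virtually abelian ([eventually_commutes_virtually_abelian]).  Otherwise
    finiteness of the set of states gives (by [singular_state]) some [g] in [G]
    that does not commute with [d] and is its own section at a nonempty word
    [x]; as [g] is bounded, its sections away from the ray [x x x ...] die
    out after a bounded number of levels ([directed_of_bounded]).

    In this second case consider the groups generated by [d ^+ e] and
    [g * d ^+ e * g^-1], for [e > 0].  They satisfy: if [e] is coprime to [q]
    and [N] is a nontrivial normal subgroup of the [e]-th group, then [N] has a
    subquotient that contains the [e']-th group for some [e' > 0].  Two
    mechanisms give this.
    - Commutators of [g] with [d ^+ (q ^ n)], [n] large, are supported below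
      a single vertex (the [g]-image of a power of [x]), where they are again
      commutators of [g] with a power of [d] ([tcomm_ray], [tcomm_off_ray]).
      Commuting them with an element of [N] that moves this vertex puts them
      into the sections of [N].
    - A nontrivial bounded [h] in [N] moves some vertex [v] at which its section
      is trivial.  There it acts as a nontrivial integral power [b] of [d];
      conjugates of [h] by powers of [d] act as the same [b] on other vertices,
      and chaining them all along the level yields an element of [N] that
      fixes [v] and has there a nontrivial power of [d] as section
      ([normal_acts_as]).
    The vertex being the same, the sections of [N] there contain a power of [d]
    and the commutator of [g] with it ([normal_section]).

    Consequently the class of groups none of whose subquotients contains a
    group of this family contains the finite and the abelian groups and is
    closed under subgroups, quotients, extensions and direct limits
    ([elementary_amenable_not_represents]).  The family being two-generated is
    what makes direct limits harmless.  The group [G] is not in this class. *)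

(** * Multiplicative maps between groups *)

Section MultiplicativeGroups.
Variables (S T : groupType) (phi : {multiplicative S -> T}).

Lemma multiplicative1 : phi 1 = 1.
Proof. by apply: (mulgI (phi 1)); rewrite -gmulfM !mulg1. Qed.

Lemma multiplicativeV s : phi s^-1 = (phi s)^-1.
Proof. by apply: (mulgI (phi s)); rewrite -gmulfM !mulgV multiplicative1. Qed.

End MultiplicativeGroups.

(** * Sections of tree automorphisms *)

Section Sections.
Variable X : finType.
Implicit Types (g h k : tree_aut X) (u v w x y : seq X).

Lemma tree_autK g w : g (g^-1 w) = w.
Proof. exact: tree_inv_funK. Qed.

Lemma tree_autVK g w : g^-1 (g w) = w.
Proof. exact: tree_fun_invK. Qed.

Lemma size_tree_autV g w : size (g^-1 w) = size w.
Proof. exact: size_tree_aut. Qed.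

Lemma tree_aut_nil g : g [::] = [::].
Proof. by apply: size0nil; rewrite size_tree_aut. Qed.

Lemma catIl w u v : w ++ u = w ++ v -> u = v.
Proof. by move=> /(congr1 (drop (size w))); rewrite !drop_size_cat. Qed.

Lemma section_nil g : section g [::] = g.
Proof. by apply/esym/section_unique => u; rewrite tree_aut_nil. Qed.

Lemma section1 w : section 1 w = 1 :> tree_aut X.
Proof. by apply/esym/section_unique. Qed.

Lemma sectionM g h w : section (g * h) w = section g (h w) * section h w.
Proof.
by apply/esym/section_unique => u; rewrite !tree_autME !sectionE.
Qed.

Lemma section_cat g w u : section g (w ++ u) = section (section g w) u.
Proof.
by apply/esym/section_unique => z; rewrite -catA !sectionE catA.
Qed.

Lemma section_mapE g w w' h :
  (forall u, g (w ++ u) = w' ++ h u) -> g w = w' /\ section g w = h.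
Proof.
move=> gE; have gw : g w = w' by have := gE [::]; rewrite tree_aut_nil !cats0.
by split=> //; apply/esym/section_unique => u; rewrite gE gw.
Qed.

Lemma tree_autX_cat g h w :
  (forall u, g (w ++ u) = w ++ h u) ->
  forall n u, (g ^+ n) (w ++ u) = w ++ (h ^+ n) u.
Proof.
move=> gE; elim=> [|n IHn] u; first by rewrite !expg0.
by rewrite !expgS !tree_autME IHn gE.
Qed.

Lemma tree_autV_cat g h w w' :
  (forall u, g (w ++ u) = w' ++ h u) ->
  forall u, g^-1 (w' ++ u) = w ++ h^-1 u.
Proof.
by move=> gE u; rewrite -{1}[u](tree_autK h) -gE tree_autVK.
Qed.

Lemma sectionV g w : section g^-1 (g w) = (section g w)^-1.
Proof.
apply/esym/section_unique => u; rewrite tree_autVK.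
exact: (tree_autV_cat (sectionE g w)).
Qed.

Lemma tree_autM_cat g g' h h' w w' w'' :
  (forall u, g (w' ++ u) = w'' ++ h u) ->
  (forall u, g' (w ++ u) = w' ++ h' u) ->
  forall u, (g * g') (w ++ u) = w'' ++ (h * h') u.
Proof. by move=> gE gE' u; rewrite !tree_autME gE' gE. Qed.

Lemma prefix_image g v w u z : size v = size w ->
  g (v ++ u) = w ++ z -> g v = w.
Proof.
move=> sz; rewrite sectionE => /(congr1 (take (size w))).
by rewrite !take_size_cat ?size_tree_aut.
Qed.

(** The value at a short word is a prefix of the value at any extension. *)
Lemma eq_tree_aut_long n g h : 0 < #|X| ->
  (forall w, n <= size w -> g w = h w) -> g = h.
Proof.
move=> /card_gt0P[a _] gh; apply: tree_autP => w.
have := gh (w ++ nseq n a); rewrite size_cat size_nseq leq_addl => /(_ isT).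
rewrite !sectionE => /(congr1 (take (size w))).
by rewrite !take_size_cat ?size_tree_aut.
Qed.

(** Words of a fixed length are tuples in the definition of boundedness; lists
    of distinct words are easier to produce. *)
Lemma bounded_uniq g N n (s : seq (seq X)) :
  (forall n, 0 < n -> #|[pred v : n.-tuple X | section g v != 1]| <= N) ->
  0 < n -> uniq s ->
  {in s, forall w, size w = n /\ section g w != 1} -> size s <= N.
Proof.
move=> gN n0 us sP; apply: leq_trans (gN n n0).
pose s' := pmap insub s : seq (n.-tuple X).
have -> : size s = size s'.
  rewrite size_pmap_sub; apply/esym/eqP; rewrite -all_count.
  by apply/allP => w /sP[/eqP].
have /card_uniqP <- : uniq s' by exact: pmap_sub_uniq.
apply: subset_leq_card; apply/fintype.subsetP => t.
by rewrite mem_pmap_sub => /sP[_]; rewrite inE.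
Qed.

(** All extensions of a moved word are moved, and once they outnumber the
    bound on active vertices one of them has a trivial section. *)
Lemma bounded_moved g : 1 < #|X| -> bounded g -> g != 1 ->
  exists v, g v <> v /\ section g v = 1.
Proof.
move=> X2 [N gN] g1.
have [w gw] : exists w, g w <> w.
  apply: contrapT => nw; move/eqP: g1; apply; apply: tree_autP => w.
  by rewrite tree_aut1E; apply: contrapT => ?; apply: nw; exists w.
apply: contrapT => nv.
pose s := [seq w ++ val u | u : N.-tuple X].
have : size s <= N.
  apply: (@bounded_uniq g N (size w + N)) => //.
  - by case: (w) gw => // /(_ (tree_aut_nil g)).
  - rewrite map_inj_uniq ?enum_uniq // => u1 u2 /catIl; exact: val_inj.
  - move=> _ /mapP[u _ ->]; rewrite size_cat size_tuple; split=> //.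
    apply/eqP => su; apply: nv; exists (w ++ u); split=> // gu.
    by apply: gw; move: gu; apply: prefix_image.
by rewrite size_map -cardE card_tuple leqNgt ltn_expl.
Qed.

End Sections.

(** * Powers of an odometer *)

Section Odometer.
Variables (X : finType) (cardX : 1 < #|X|) (d : tree_aut X).
Hypothesis dO : odometer d.
Local Notation q := #|X|.

(* The permutation of the letters induced by [d] is a single cycle. *)
Let next x := head x (d [:: x]).

Let nextE x : d [:: x] = [:: next x].
Proof.
by rewrite /next; have := size_tree_aut d [:: x]; case: (d _) => [|? []].
Qed.

Let next_inj : injective next.
Proof.
by move=> x y e; have := nextE x; rewrite e -nextE => /tree_aut_inj [].
Qed.

Let powE k x : (d ^+ k) [:: x] = [:: iter k next x].
Proof.
by elim: k => [|k IHk]; rewrite ?expg0 // expgS tree_autME IHk nextE.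
Qed.

Let next_connect x y : fconnect next x y.
Proof.
have [+ _ _] := dO; move=> /(_ x y)[n [|]].
  by rewrite powE => -[<-]; exact: fconnect_iter.
move=> /(congr1 (d ^+ n)); rewrite tree_autK powE => -[->].
by rewrite fconnect_sym ?fconnect_iter.
Qed.

Let next_order x : order next x = q.
Proof. by apply: eq_card => y; rewrite !inE next_connect. Qed.

Let carry_letter :
  {c : X | forall x, section d [:: x] = if x == c then d else 1}.
Proof.
apply: cid; have [_ d1 [c [cd cU]]] := dO; exists c => x.
case: eqP => [-> //|xc]; case: (d1 x) => // xd.
by case: xc; rewrite (cU _ xd).
Qed.

Let pow_section k x :
  section (d ^+ k) [:: x] =
    d ^+ count_mem (sval carry_letter) (traject next x k).
Proof.
elim: k => [|k IHk]; first by rewrite !expg0 section1.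
rewrite expgS sectionM powE IHk (svalP carry_letter) trajectSr -cats1 count_cat.
by rewrite /= addn0 addnC expgnDr; case: eqP => _; rewrite ?expg0 ?mul1g.
Qed.

(** Following a letter through a full cycle of [d] meets each letter once, so
    exactly one factor [d] is picked up. *)
Lemma odometer_level n w u : size w = n -> (d ^+ (q ^ n)) (w ++ u) = w ++ d u.
Proof.
elim: n w u => [|n IHn] [|x w] // u.
case=> sw; rewrite expnS expgnA.
have dq z : (d ^+ q) ([:: x] ++ z) = [:: x] ++ d z.
  rewrite sectionE powE pow_section -(next_order x) iter_order //.
  suff -> : count_mem (sval carry_letter) (traject next x (order next x)) = 1%N.
    by [].
  rewrite -/(orbit next x) count_uniq_mem ?orbit_uniq //.
  by rewrite -fconnect_orbit next_connect.
by have /= -> := tree_autX_cat dq (q ^ n) (w ++ u); rewrite IHn.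
Qed.

Lemma odometerX_level n r w u : size w = n ->
  (d ^+ (q ^ n * r)) (w ++ u) = w ++ (d ^+ r) u.
Proof.
move=> sw; rewrite expgnA; apply: tree_autX_cat => z; exact: odometer_level.
Qed.

Lemma odometerX_fix n r w : size w = n -> (d ^+ (q ^ n * r)) w = w.
Proof.
by move=> sw; rewrite -{1}[w]cats0 odometerX_level // tree_aut_nil cats0.
Qed.

Lemma odometer_trans u v : size u = size v -> exists i, (d ^+ i) u = v.
Proof.
move: {2}(size u) (erefl (size u)) => n.
elim: n u v => [|n IHn] [|x u] [|y v] //; first by exists 0.
case=> su [suv]; have /iter_findex := next_connect x y.
set i := findex _ _ _ => ixy.
have di z : (d ^+ i) ([:: x] ++ z) = [:: y] ++ section (d ^+ i) [:: x] z.
  by rewrite sectionE powE ixy.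
have [||j jv] := IHn (section (d ^+ i) [:: x] u) v; rewrite ?size_tree_aut //.
exists (q ^ 1 * j + i)%N; rewrite expgnDr tree_autME.
by have /= -> := di u; rewrite -cat1s odometerX_level // jv.
Qed.

Lemma odometerX_section i w : exists s, section (d ^+ i) w = d ^+ s.
Proof.
elim: w i => [|x w IHw] i.
  by exists i; rewrite section_nil.
by rewrite -cat1s section_cat pow_section; exact: IHw.
Qed.

(** On the words of length [n], [d] has order [q ^ n], and [f] is invertible
    modulo [q ^ n]. *)
Lemma coprime_odometer_agree n f i : 0 < f -> coprime f q ->
  exists l, forall v, size v = n -> (d ^+ (f * l)) v = (d ^+ i) v.
Proof.
move=> f0 fq; have /(coprimeP _ f0) [[a b] /= ab] : coprime f (q ^ n).
  by rewrite coprimeXr.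
exists (a * i)%N => v sv.
have -> : (f * (a * i) = i + q ^ n * (b * i))%N.
  have abE : (a * f = b * q ^ n + 1)%N.
    by rewrite addnC -ab subnK // ltnW // -subn_gt0 ab.
  by rewrite mulnA (mulnC f) abE mulnDl mul1n addnC mulnA (mulnC b).
by rewrite expgnDr tree_autME odometerX_fix.
Qed.

(** If [d ^+ k = 1] then [d] has orbits of size at most [k] on the words of
    length [k], whereas there are more than [k] of them. *)
Lemma odometer_pow_neq1 k : 0 < k -> d ^+ k <> 1.
Proof.
move=> k0 dk1; have [a _] : exists a, a \in X by apply/card_gt0P/ltnW.
pose s := [seq (d ^+ j) (nseq k a) | j <- iota 0 k].
have : size [seq val v | v : k.-tuple X] <= size s.
  apply: uniq_leq_size.
    by rewrite map_inj_uniq ?enum_uniq //; exact: val_inj.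
  move=> _ /mapP[v _ ->]; apply/mapP.
  have [|i <-] := @odometer_trans (nseq k a) (val v).
    by rewrite size_nseq size_tuple.
  exists (i %% k); first by rewrite mem_iota ltn_mod.
  by rewrite {1}(divn_eq i k) mulnC expgnDr expgnA dk1 expg1n mul1g.
by rewrite size_map -cardE card_tuple /s size_map size_iota leqNgt ltn_expl.
Qed.

(** By transitivity of [d], elements commuting with [d] move each word as some
    power of [d] does. *)
Lemma odometer_centralizer_abelian g h :
  commute g d -> commute h d -> commute g h.
Proof.
move=> gd hd; apply: tree_autP => w.
have [i giw] := odometer_trans (esym (size_tree_aut g w)).
have [j hjw] := odometer_trans (esym (size_tree_aut h w)).
have gi k : g ((d ^+ k) w) = (d ^+ k) (g w).
  by rewrite -!tree_autME (commuteX _ gd).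
have hi k : h ((d ^+ k) w) = (d ^+ k) (h w).
  by rewrite -!tree_autME (commuteX _ hd).
by rewrite !tree_autME -hjw -giw gi hi -giw -hjw -!tree_autME -!expgnDr addnC.
Qed.

Lemma commute_odometerX_section g n r w : size w = n ->
  commute g (d ^+ (q ^ n * r)) -> commute (section g w) (d ^+ r).
Proof.
move=> sw gd; apply: tree_autP => u; apply: (@catIl _ (g w)).
rewrite tree_autME -sectionE -(odometerX_level r _ sw) -tree_autME gd.
by rewrite !tree_autME sectionE (odometerX_level r) // size_tree_aut.
Qed.

Lemma commute_section g w : commute g d -> commute (section g w) d.
Proof.
move=> gd; rewrite -[d]expg1.
by apply: (commute_odometerX_section (erefl (size w))); exact: commuteX.
Qed.

Lemma commute_coprime_odometer g f : 0 < f -> coprime f q ->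
  commute g (d ^+ f) -> commute g d.
Proof.
move=> f0 fq gdf; apply: tree_autP => w.
have [l dl] := coprime_odometer_agree (size w) 1 f0 fq.
rewrite !tree_autME -[d]expg1 -!dl ?size_tree_aut // expgnA.
by rewrite -!tree_autME (commuteX _ gdf).
Qed.
End Odometer.

(** * Singular states *)

Section Dichotomy.

Lemma groupClosed_of (T : groupType) (P : T -> Prop) :
  P 1 -> (forall x y, P x -> P y -> P (x * y)) -> (forall x, P x -> P x^-1) ->
  exists H : groupClosed T, forall x, (x \in H) <-> P x.
Proof.
move=> P1 PM PV; pose S : {pred T} := [pred x | `[< P x >]].
have SE x : (x \in S) <-> P x.
  by split; [move/asboolP | move=> Px; apply/asboolP].
have S1 : 1 \in S by apply/SE.
have SM : {in S &, forall x y, x * y \in S}.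
  by move=> x y /SE Px /SE Py; apply/SE/PM.
have SV : {in S, forall x, x^-1 \in S} by move=> x /SE Px; apply/SE/PV.
pose H : groupClosed T := HB.pack_for (groupClosed T) S
  (isMulClosed.Build T S SM) (isMul1Closed.Build T S S1)
  (isInvClosed.Build T S SV).
by exists H => x; exact: SE.
Qed.

Variables (X : finType) (cardX : 1 < #|X|) (d : tree_aut X).
Hypothesis dO : odometer d.
Variable G : groupClosed (tree_aut X).
Hypothesis GB : bounded_automata_group G.

Definition eventually_commutes (t : tree_aut X) n :=
  forall v, n <= size v -> commute (section t v) d.

Lemma eventually_commutes_uniform (s : seq (subgroup G)) :
  (forall t, t \in G -> exists n, eventually_commutes t n) ->
  exists n, {in s, forall t, eventually_commutes (val t) n}.
Proof.
move=> Gn; elim: s => [|t s [n sn]]; first by exists 0.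
have [n' tn'] := Gn (val t) (valP t); exists (maxn n n') => t'.
rewrite inE => /predU1P[-> | t's] v; rewrite geq_max => /andP[nv n'v].
  exact: tn'.
exact: sn.
Qed.

(** A common level for the generators works for all of [G], and elements that
    fix this level commute section by section.  Elements with the same action
    on the level form the cosets of this stabiliser. *)
Lemma eventually_commutes_virtually_abelian :
  (forall t, t \in G -> exists n, eventually_commutes t n) ->
  virtually_abelian (subgroup G).
Proof.
move=> Gn; have [[s sG] Gss _] := GB.
have [n sn] := eventually_commutes_uniform s Gn.
have [A AE] : exists A : groupClosed (subgroup G),
    forall t, t \in A <-> eventually_commutes (val t) n.
  apply: groupClosed_of => [v _|t t' tn tn' v nv|t tn v nv].
  - by rewrite section1; apply/commute_sym/commute1.
  - rewrite sectionM; apply/commute_sym/commuteM; apply/commute_sym.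
      by apply: tn; rewrite size_tree_aut.
    exact: tn'.
  - rewrite -[v](tree_autK (val t)) sectionV.
    by apply/commute_sym/commuteV/commute_sym/tn; rewrite size_tree_autV.
have Gc (t : subgroup G) : eventually_commutes (val t) n.
  by apply/AE; apply: (sG A) => t' t's; apply/AE; exact: sn.
have [H HE] : exists H : groupClosed (subgroup G),
    forall t, t \in H <-> forall v, size v = n -> (val t) v = v.
  apply: groupClosed_of => [v _ //|t t' tf tf' v nv|t tf v nv].
    by rewrite tree_autME tf' // tf.
  by rewrite -{1}(tf v) // tree_autVK.
exists H; split=> [t t' /HE tf /HE tf'|].
  apply/val_inj; rewrite !valM.
  apply: (@eq_tree_aut_long _ n); first exact: ltnW.
  move=> w nw; rewrite -(cat_take_drop n w).
  have sw : size (take n w) = n by rewrite size_takel.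
  rewrite !tree_autME !sectionE !(tf, tf', sw) //.
  have tt' : commute (section (val t) (take n w)) (section (val t') (take n w)).
    by apply: (odometer_centralizer_abelian dO); apply: Gc; rewrite sw.
  by rewrite -!tree_autME tt'.
pose act (t : subgroup G) := [ffun v : n.-tuple X => insubd v (val t v)].
have actP t t' : act t = act t' -> forall v, size v = n -> val t v = val t' v.
  move=> /ffunP tt' v /eqP nv; have := congr1 val (tt' (Tuple nv)).
  by rewrite !ffunE !val_insubd !size_tree_aut !nv.
exists [seq xget 1 [set t | act t = f]%classic
         | f : {ffun n.-tuple X -> n.-tuple X}].
move=> t; set r := xget 1 [set t' | act t' = act t]%classic.
have rt : act r = act t.
  have /(xgetPex 1) // : exists t', [set t' | act t' = act t]%classic t'.
  by exists t.
exists r; first by apply/mapP; exists (act t); rewrite ?mem_enum.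
exists (r^-1 * t); last by rewrite mulVKg.
by apply/HE => v nv; rewrite tree_autME -(actP _ _ rt v nv) tree_autVK.
Qed.

(** The power [x ^ n] in the free monoid. *)
Definition wpow (x : seq X) n := flatten (nseq n x).

Lemma size_wpow x n : size (wpow x n) = (n * size x)%N.
Proof. by elim: n => //= n IHn; rewrite size_cat IHn mulSn. Qed.

(** Take a word, at least as long as [t] has states, at which the section of [t]
    does not commute with [d].  Two of its prefixes have the same section, and
    this section does not commute with [d] since commuting with [d] passes to
    sections. *)
Lemma singular_state t : t \in G -> (forall n, ~ eventually_commutes t n) ->
  exists g x, [/\ g \in G, ~ commute g d, x != [::] & section g x = g].
Proof.
move=> tG tn; have [_ Gss /(_ _ tG)[_ /finite_seqP[L LE]]] := GB.
have /existsNP[v /not_implyP[Lv vd]] := tn (size L).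
pose st := [seq section t (take i v) | i <- iota 0 (size L).+1].
have /(uniqPn 1)[i [j []]] : ~~ uniq st.
  apply: contraTN (leqnn (size L).+1) => ust; rewrite -leqNgt.
  have : {subset st <= L}.
    move=> _ /mapP[i _ ->]; have : range (section t) (section t (take i v)).
      by exists (take i v).
    by rewrite LE.
  by move=> /(uniq_leq_size ust); rewrite size_map size_iota.
rewrite size_map size_iota => ij jL.
rewrite !(nth_map 0) ?size_iota ?(ltn_trans ij) // !nth_iota ?(ltn_trans ij) //.
rewrite !add0n => ijE.
have jv : j <= size v by rewrite (leq_trans _ Lv).
exists (section t (take i v)), (drop i (take j v)); split.
- exact: Gss.
- move=> gd; apply: vd; rewrite -(cat_take_drop i v) section_cat.
  exact: commute_section.
- by rewrite -size_eq0 size_drop size_takel // subn_eq0 -ltnNge.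
- rewrite -section_cat -{1}(@take_takel _ i j) ?cat_take_drop //; exact: ltnW.
Qed.

(** If [u] is a word off the ray whose section survives for [c] further blocks
    of [size x] letters, prefixing truncations of its tail by powers of [x]
    gives [c] distinct active vertices on one level. *)
Lemma directed_of_bounded g x : bounded g -> x != [::] -> section g x = g ->
  exists c, forall n v z, size v = (n * size x)%N -> v != wpow x n ->
    size z = (c * size x)%N -> section g (v ++ z) = 1.
Proof.
move=> [N gN] x0 gx; exists N.+1 => n.
have m0 : 0 < size x by rewrite lt0n size_eq0.
elim: n => [|n IHn] v z sv vx sz.
  by move: sv vx => /size0nil ->.
rewrite -(cat_take_drop (size x) v) -catA section_cat.
have xv : size x <= size v by rewrite sv mulSn leq_addr.
have [vx1|] := eqVneq (take (size x) v) x.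
  rewrite vx1 gx; apply: IHn => //; first by rewrite size_drop sv mulSn addKn.
  by apply: contra_neq vx => dv; rewrite -[LHS](cat_take_drop (size x)) vx1 dv.
set y := take _ _; set u := drop _ _ => yx.
have sy : size y = size x by rewrite size_takel.
apply/eqP; apply: contraT => gyu.
pose w j := wpow x j ++ y ++ take ((N - j) * size x)%N (u ++ z).
have gw j : section g (wpow x j) = g.
  by elim: j => [|j IHj]; rewrite ?section_nil //= section_cat gx.
(* [w i] and [w j] differ in the block that follows the first [i] copies *)
have w_neq i j : i < j -> w i != w j.
  move=> ij; apply: contra_neq yx.
  move=> /(congr1 (take (size x) \o drop (i * size x))) /=.
  have -> : j = (i + (j - i.+1).+1)%N by rewrite addnS -addSn subnKC.
  rewrite /w /wpow nseqD flatten_cat -catA !drop_size_cat ?size_wpow //=.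
  by rewrite -!catA !take_size_cat.
have sw j : j <= N -> size (w j) = (N.+1 * size x)%N.
  move=> jN; rewrite /w !size_cat size_wpow sy size_takel.
    by rewrite -mulSn -mulnDl addnS subnKC.
  rewrite size_cat sz; apply: leq_trans (leq_addl _ _).
  by rewrite leq_mul2r (leq_trans (leq_subr _ _)) ?orbT.
have := @bounded_uniq _ g N (N.+1 * size x)%N [seq w j | j <- iota 0 N.+1] gN.
rewrite muln_gt0 m0 size_map size_iota ltnn => /(_ isT) F.
apply: F.
  rewrite map_inj_in_uniq ?iota_uniq // => i j _ _ wij.
  by case: (ltngtP i j) => [/w_neq|/w_neq|//]; rewrite wij eqxx.
move=> _ /mapP[j + ->]; rewrite mem_iota add0n ltnS => /andP[_ jN].
split; first exact: sw.
rewrite section_cat gw; apply: contraNneq gyu => wj1.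
rewrite -(cat_take_drop ((N - j) * size x) (u ++ z)) section_cat.
by rewrite -(section_cat g y) wj1 section1.
Qed.

End Dichotomy.

(** * Commutators supported below one vertex *)

Section Obstruction.
Variables (X : finType) (cardX : 1 < #|X|) (d : tree_aut X).
Hypothesis dO : odometer d.
Variable G : groupClosed (tree_aut X).
Hypothesis GB : bounded_automata_group G.
Variables (g : tree_aut X) (x : seq X) (c : nat).
Hypothesis gd : ~ commute g d.
Hypotheses (x_neq0 : x != [::]) (gx : section g x = g).
Hypothesis gdir : forall n v z, size v = (n * size x)%N -> v != wpow x n ->
  size z = (c * size x)%N -> section g (v ++ z) = 1.
Local Notation q := #|X|.
Local Notation m := (size x).
Let y := g x.

Let q0 : 0 < q. Proof. exact: ltnW. Qed.
Let m0 : 0 < m. Proof. by rewrite lt0n size_eq0. Qed.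
Let sy : size y = m. Proof. exact: size_tree_aut. Qed.

Let g_ray n u : g (wpow x n ++ u) = wpow y n ++ g u.
Proof.
elim: n u => //= n IHn u; rewrite /wpow /= -!catA.
by rewrite sectionE gx -/(wpow _ _) IHn.
Qed.

Let size_ypow n : size (wpow y n) = (n * m)%N.
Proof. by rewrite size_wpow sy. Qed.

Let C := (q ^ (c * m))%N.
Let C0 : 0 < C. Proof. by rewrite expn_gt0 q0. Qed.

Definition twist e : tree_aut X := g * d ^+ e * g^-1.

(** The commutator of [g] and [d ^+ e], written with the conjugate in front. *)
Definition tcomm e : tree_aut X := twist e * d ^- e.

Lemma twistX e n : twist e ^+ n = twist (e * n).
Proof.
have twistE k : twist k = (d ^+ k) ^ g^-1 by rewrite conjgE invgK mulgA.
by rewrite !twistE -conjXg expgnA.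
Qed.

Lemma twist_ray n e u :
  twist (q ^ (n * m) * e) (wpow y n ++ u) = wpow y n ++ twist e u.
Proof.
apply: tree_autM_cat; last by apply: (tree_autV_cat (g_ray n)).
apply: tree_autM_cat; first exact: g_ray.
by move=> z; rewrite odometerX_level ?size_wpow.
Qed.

Lemma tcomm_ray n e u :
  tcomm (q ^ (n * m) * e) (wpow y n ++ u) = wpow y n ++ tcomm e u.
Proof.
apply: tree_autM_cat; first exact: twist_ray.
by apply: tree_autV_cat => z; rewrite odometerX_level ?size_ypow.
Qed.

Lemma commute_trivial_level k n r :
  (forall w, size w = n -> section k w = 1) -> commute k (d ^+ (q ^ n * r)).
Proof.
move=> k1; apply: (@eq_tree_aut_long _ n) => // w nw.
rewrite -(cat_take_drop n w); move: (take n w) (drop n w) (size_takel nw).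
move=> v u sv; have kv z : k (v ++ z) = k v ++ z by rewrite sectionE k1.
by rewrite !tree_autME odometerX_level // !kv odometerX_level ?size_tree_aut.
Qed.

(** At a vertex off the ray, the section of [g] only acts on the next [c]
    blocks, which [d ^+ C] leaves alone. *)
Lemma tcomm_off_ray n e v u : size v = (n * m)%N -> v != wpow y n ->
  tcomm (q ^ (n * m) * (C * e)) (v ++ u) = v ++ u.
Proof.
move=> sv vy; rewrite /tcomm /twist; set D := d ^+ _.
have sv' : size (g^-1 v) = (n * m)%N by rewrite size_tree_autV.
have gv z : g (g^-1 v ++ z) = v ++ section g (g^-1 v) z.
  by rewrite sectionE tree_autK.
have kd : commute (section g (g^-1 v)) (d ^+ (C * e)).
  apply: commute_trivial_level => w sw.
  rewrite -section_cat; apply: (gdir sv') sw.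
  apply: contra_neq vy => v'; rewrite -(tree_autK g v) v'.
  by rewrite -[wpow x n]cats0 g_ray tree_aut_nil cats0.
have Dv w z : size w = (n * m)%N -> D (w ++ z) = w ++ (d ^+ (C * e)) z.
  by move=> sw; rewrite odometerX_level.
have DVv z : D^-1 (v ++ z) = v ++ (d ^- (C * e)) z.
  by apply: tree_autV_cat => u'; apply: Dv.
rewrite !tree_autME DVv (tree_autV_cat gv) Dv // gv.
by rewrite -!(tree_autME (section _ _)) kd tree_autME !tree_autK.
Qed.

(** * Subquotients as correspondences *)

(** The graph of a homomorphism from a subgroup of [T] to [G].  Such relations
    compose with arbitrary homomorphisms without any need to form the subgroup
    or the quotient as a group. *)
Record correspondence (T : groupType) (R : T -> tree_aut X -> Prop) : Prop := {
  corr1 : R 1 1;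
  corrM : forall t t' k k', R t k -> R t' k' -> R (t * t') (k * k');
  corrV : forall t k, R t k -> R t^-1 k^-1;
  corr_fun : forall k, R 1 k -> k = 1;
  corr_sub : forall t k, R t k -> k \in G }.

(** Some subquotient of [T] contains a copy of the group generated by [d ^+ e]
    and its conjugate by [g]. *)
Definition represents (T : groupType) e := exists R : T -> tree_aut X -> Prop,
  [/\ correspondence R, exists t, R t (d ^+ e) & exists t, R t (twist e)].

Lemma corrX T R t k n : @correspondence T R -> R t k -> R (t ^+ n) (k ^+ n).
Proof.
move=> RC Rtk; elim: n => [|n IHn]; first by rewrite !expg0; exact: corr1.
by rewrite !expgS; exact: corrM.
Qed.

Lemma corr_preim (S T : groupType) (phi : {multiplicative S -> T}) R :
  correspondence R -> correspondence (fun s k => R (phi s) k).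
Proof.
move=> RC; split=> [|s s' k k'|s k|k|s k].
- by rewrite /= multiplicative1; exact: corr1.
- by rewrite /= gmulfM; exact: corrM.
- by rewrite /= multiplicativeV; exact: corrV.
- by rewrite /= multiplicative1; exact: corr_fun.
- exact: corr_sub.
Qed.

(** Taking sections is a homomorphism on the stabiliser of [v], so composing
    with it gives another correspondence. *)
Definition at_vertex (T : groupType) (R : T -> tree_aut X -> Prop) v t k :=
  exists2 K, R t K & forall u, K (v ++ u) = v ++ k u.

Lemma corr_at_vertex (T : groupType) R v :
  @correspondence T R -> correspondence (at_vertex R v).
Proof.
move=> RC; split=> [|t t' k k'|t k|k|t k].
- by exists 1; first exact: corr1.
- move=> [K RK Kv] [K' RK' Kv']; exists (K * K'); first exact: corrM.
  exact: tree_autM_cat Kv Kv'.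
- by move=> [K RK Kv]; exists K^-1; [exact: corrV | exact: tree_autV_cat].
- move=> [K /(corr_fun RC) -> Kv]; apply: tree_autP => u.
  by apply/esym/(@catIl _ v); rewrite -Kv.
- move=> [K /(corr_sub RC) KG /section_mapE[_ <-]].
  by have [_ Gss _] := GB; exact: Gss.
Qed.

(** Remove from [e] one prime factor shared with [q] at a time. *)
Lemma coprime_part e : 0 < e ->
  exists M l f, [/\ 0 < f, coprime f q & (e * M = f * q ^ l)%N].
Proof.
elim/ltn_ind: e => e IHe e0; have [eq1|] := boolP (coprime e q).
  by exists 1%N, 0, e; rewrite muln1.
rewrite /coprime neq_ltn ltnNge gcdn_gt0 e0 /= => /pdivP[p p_prime].
rewrite dvdn_gcd => /andP[/dvdnP[e' eE] /dvdnP[q' qE]].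
have e'0 : 0 < e' by move: e0; rewrite eE; case: (e').
have [|//|M [l [f [f0 fq eM]]]] := IHe e'.
  by rewrite eE ltn_Pmulr ?prime_gt1.
exists (M * q')%N, l.+1, f; split=> //.
by rewrite expnSr [RHS]mulnA -eM eE mulnACA (mulnC p) -qE.
Qed.

(** A suitable power of [d ^+ e] is [d ^+ (q ^ n * f)] with [f] coprime to [q];
    pass to the sections at a vertex of level [n] on the ray. *)
Lemma represents_coprime (T : groupType) e : 0 < e -> represents T e ->
  exists f, [/\ 0 < f, coprime f q & represents T f].
Proof.
move=> /coprime_part[M [l [f [f0 fq eM]]]] [R [RC [t Rt] [t' Rt']]].
exists f; split=> //; exists (at_vertex R (wpow y l)).
have eM' : (e * (M * q ^ (l * m - l)) = q ^ (l * m) * f)%N.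
  rewrite mulnA eM -mulnA -expnD mulnC subnKC //.
  by rewrite -{1}[l]muln1 leq_mul2l m0 orbT.
split; first exact: corr_at_vertex.
- exists (t ^+ (M * q ^ (l * m - l))); exists (d ^+ (q ^ (l * m) * f)).
    by rewrite -eM' (expgnA d); exact: (corrX _ RC Rt).
  by move=> u; rewrite odometerX_level ?size_ypow.
- exists (t' ^+ (M * q ^ (l * m - l))); exists (twist (q ^ (l * m) * f)).
    by rewrite -eM' -twistX; exact: (corrX _ RC Rt').
  by move=> u; exact: twist_ray.
Qed.

Lemma not_represents_finite (T : groupType) e : 0 < e ->
  finite_set [set: T]%classic -> ~ represents T e.
Proof.
move=> e0 /finite_seqP[s sE] [R [RC [t Rt] _]].
pose ts := [seq t ^+ i | i <- iota 0 (size s).+1].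
have /(uniqPn 1)[i [j []]] : ~~ uniq ts.
  apply: contraTN (leqnn (size s).+1) => uts; rewrite -leqNgt.
  have : {subset ts <= s}.
    by move=> z _; have : [set: T]%classic z by []; rewrite sE.
  by move=> /(uniq_leq_size uts); rewrite size_map size_iota.
rewrite size_map size_iota => ij js.
rewrite !(nth_map 0) ?size_iota ?(ltn_trans ij) // !nth_iota ?(ltn_trans ij) //.
rewrite !add0n => tij.
have t1 : t ^+ (j - i) = 1 by rewrite expgnFr ?(ltnW ij) // tij mulgV.
have := corrX (j - i) RC Rt; rewrite t1 -expgnA => /(corr_fun RC).
by apply: odometer_pow_neq1; rewrite // muln_gt0 e0 subn_gt0.
Qed.

Lemma coprime_odometer_trans f u v : 0 < f -> coprime f q ->
  size u = size v -> exists l, (d ^+ (f * l)) u = v.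
Proof.
move=> f0 fq suv; have [i <-] := odometer_trans dO suv.
have [l dl] := coprime_odometer_agree dO (size u) i f0 fq.
by exists l; rewrite dl.
Qed.

Lemma coprime_odometer_moves f : 0 < f -> coprime f q -> (d ^+ f) y <> y.
Proof.
move=> f0 fq fy.
have [v [sv vy]] : exists v, size v = size y /\ v != y.
  case: y sy m0 => [<- //|a s _ _].
  have : 0 < #|predC1 a| by rewrite cardC1 -ltnS prednK.
  move=> /card_gt0P[b]; rewrite inE => ba; exists (b :: s); split=> //.
  by rewrite eqseq_cons negb_and ba.
have [l dl] := coprime_odometer_trans f0 fq (esym sv).
move/eqP: vy; apply; rewrite -{}dl expgnA.
by elim: l => [|l IHl]; rewrite ?expg0 // expgS tree_autME IHl.
Qed.

Lemma corr_tcomm (T : groupType) R f (t t' : T) :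
  correspondence R -> R t (d ^+ f) -> R t' (twist f) ->
  forall n, exists s, R s (tcomm (f * n)).
Proof.
move=> RC Rt Rt' n; exists (t' ^+ n * (t ^+ n)^-1).
apply: (corrM RC); first by rewrite -twistX; exact: corrX.
by apply: (corrV RC); rewrite (expgnA d); exact: corrX.
Qed.

(** A commutator supported below the vertex [y] cannot commute with
    [d ^+ f], which moves [y], unless it is trivial; but then its sections
    along the ray are trivial too, and [g] commutes with [d]. *)
Lemma not_represents_abelian (T : groupType) f : 0 < f -> coprime f q ->
  (forall s t : T, commute s t) -> ~ represents T f.
Proof.
move=> f0 fq Tab [R [RC [t Rt] [t' Rt']]].
have [s] := corr_tcomm RC Rt Rt' (C * q ^ (1 * m)).
have -> : (f * (C * q ^ (1 * m)) = q ^ (1 * m) * (C * f))%N.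
  by rewrite mulnC -mulnA mulnCA.
set k := tcomm _ => Rs.
have kd : d ^+ f * k = k * d ^+ f.
  apply: divg1_eq; apply: (corr_fun RC).
  have := corrM RC (corrM RC Rt Rs) (corrV RC (corrM RC Rs Rt)).
  by rewrite (Tab t s) mulgV.
apply: gd; apply: (commute_coprime_odometer dO f0 fq).
have gx_c : section g (wpow x c) = g.
  apply/esym/section_unique => u.
  by rewrite g_ray -[in RHS](cats0 (wpow x c)) g_ray tree_aut_nil cats0.
rewrite -gx_c; apply: (commute_odometerX_section dO (size_wpow x c)).
have : tcomm (C * f) = 1.
  apply: tree_autP => u; apply: (@catIl _ (wpow y 1)); rewrite -tcomm_ray.
  apply: (@tree_aut_inj _ (d ^+ f)); rewrite -/k -tree_autME kd tree_autME.
  rewrite [_ (_ ++ u)]sectionE; apply: tcomm_off_ray.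
    by rewrite size_tree_aut size_ypow.
  by rewrite /wpow /= cats0; apply/eqP; exact: coprime_odometer_moves.
move=> /divg1_eq; rewrite /twist => /(congr1 (fun k => k * g)).
by rewrite mulgVK.
Qed.

(** * Sections of normal subgroups *)

Lemma acts_as_conj (a b z : tree_aut X) v w : commute z b -> z v = w ->
  (forall u, a (v ++ u) = b (v ++ u)) ->
  forall u, (z * a * z^-1) (w ++ u) = b (w ++ u).
Proof.
move=> zb zv ab u; have zE := tree_autV_cat (fun u => sectionE z v u).
rewrite -zv !tree_autME zE ab -!tree_autME zb tree_autME.
by rewrite sectionE tree_autK.
Qed.

(* [I] is a subgroup of [G] normalised by the elements of [K]; in the application
   [K] is the image of a correspondence and [I] the image of a normal subgroup. *)
Section NormalSubgroup.
Variables (f : nat) (f0 : 0 < f) (fq : coprime f q).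
Variables (K I : tree_aut X -> Prop).
Hypotheses (I1 : I 1) (IM : forall a b, I a -> I b -> I (a * b)).
Hypotheses (IV : forall a, I a -> I a^-1) (IG : forall a, I a -> a \in G).
Hypothesis IJ : forall k a, K k -> I a -> I (k * a * k^-1).
Hypotheses (Kd : forall l, K (d ^+ (f * l))) (Kt : forall l, K (tcomm (f * l))).

Let commute_pow l i j : commute (d ^+ l) (d ^+ i / d ^+ j).
Proof. by apply: commuteM; [|apply: commuteV]; exact: commuteX2. Qed.

(** Where [p] has brought [v] by [b ^+ M], a conjugate of [a] by a power of
    [d ^+ f] again acts as [b], because [b] commutes with that power. *)
Lemma normal_acts_as a i j v : I a ->
  (forall u, a (v ++ u) = (d ^+ i / d ^+ j) (v ++ u)) ->
  forall M, exists2 p, I p &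
    forall u, p (v ++ u) = ((d ^+ i / d ^+ j) ^+ M) (v ++ u).
Proof.
set b := d ^+ i / d ^+ j => Ia ab; elim=> [|M [p Ip pE]].
  by exists 1.
have [l lE] := coprime_odometer_trans f0 fq (esym (size_tree_aut (b ^+ M) v)).
exists (d ^+ (f * l) * a * d ^- (f * l) * p).
  by apply: IM => //; exact: IJ.
move=> u; rewrite tree_autME pE sectionE.
by rewrite (acts_as_conj (commute_pow _ _ _) lE ab) -sectionE expgS.
Qed.

(** If [h] has trivial section at [v], it maps [v u] to [(h v) u], and so does
    an integral power of [d]: one that maps [v] to [h v], corrected by a power
    of [d ^+ (q ^ size v)] to have trivial section at [v].  This property is
    then carried by conjugation to the ray. *)
Lemma normal_moves_ray h : I h -> h != 1 ->
  exists n a i j, [/\ I a, a (wpow y n) <> wpow y n &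
    forall u, a (wpow y n ++ u) = (d ^+ i / d ^+ j) (wpow y n ++ u)].
Proof.
move=> Ih h1; have [_ _ /(_ _ (IG Ih))[hb _]] := GB.
have [v0 [hv0 sv0]] := bounded_moved cardX hb h1.
have [a0 _] : exists a0, a0 \in X by apply/card_gt0P.
set n := size v0; pose v := v0 ++ nseq (n * m - n) a0.
have sv : size v = (n * m)%N.
  by rewrite size_cat size_nseq subnKC // -{1}[size v0]muln1 leq_mul2l m0 orbT.
have hv : h v <> v by move=> hv; apply: hv0; exact: prefix_image hv.
have sv1 : section h v = 1 by rewrite section_cat sv0 section1.
have [i iE] := odometer_trans dO (esym (size_tree_aut h v)).
have [s sE] := odometerX_section dO i v.
have hE u : h (v ++ u) = (d ^+ i / d ^+ (q ^ (n * m) * s)) (v ++ u).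
  rewrite sectionE sv1 tree_autME.
  rewrite (tree_autV_cat (fun u => odometerX_level dO s u sv)).
  by rewrite sectionE iE sE tree_autK.
have [l lE] := coprime_odometer_trans f0 fq (etrans sv (esym (size_ypow n))).
exists n, (d ^+ (f * l) * h * d ^- (f * l)), i, (q ^ (n * m) * s)%N; split.
- exact: IJ.
- rewrite -{1}lE !tree_autME tree_autVK -lE => /tree_aut_inj; exact: hv.
- exact: acts_as_conj (commute_pow _ _ _) lE hE.
Qed.

(** The two elements of [I] are the chain of conjugates around the whole level,
    and the commutator with [a] of the element [k] supported below the vertex:
    [a] moves this vertex away, so that only the section of [k] remains. *)
Lemma normal_section h : I h -> h != 1 -> exists n e, [/\ 0 < e,
  exists2 p, I p & forall u, p (wpow y n ++ u) = wpow y n ++ (d ^+ e) u &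
  exists2 p, I p &
    forall u, p (wpow y n ++ u) = wpow y n ++ tcomm (C * (f * e)) u].
Proof.
move=> Ih /(normal_moves_ray Ih)[n [a [i [j [Ia ay ab]]]]]; exists n.
have [p Ip pE] := normal_acts_as Ia ab (q ^ (n * m)).
have {}pE u : p (wpow y n ++ u) = wpow y n ++ (d ^+ i / d ^+ j) u.
  rewrite pE expgnFl; last exact: commuteX2.
  rewrite -!expgnA !(mulnC _ (q ^ _)%N).
  apply: tree_autM_cat; last apply: tree_autV_cat; move=> z;
    by rewrite odometerX_level ?size_ypow.
have [e e0 [p' Ip' p'E]] : exists2 e, 0 < e & exists2 p, I p &
    forall u, p (wpow y n ++ u) = wpow y n ++ (d ^+ e) u.
  case: (ltngtP i j) => [ij|ji|ij].
  - exists (j - i); first by rewrite subn_gt0.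
    exists p^-1; first exact: IV.
    move=> u; rewrite (tree_autV_cat pE) expgnFr 1?ltnW //.
    by rewrite invgF.
  - exists (i - j); first by rewrite subn_gt0.
    by exists p => // u; rewrite pE expgnFr 1?ltnW.
  - case: ay; have := ab [::]; rewrite !cats0 ij mulgV; exact.
exists e; split=> //; first by exists p'.
pose k := tcomm (q ^ (n * m) * (C * (f * e))).
have Kk : K k.
  by have := Kt (q ^ (n * m) * (C * e))%N; rewrite mulnCA (mulnCA f).
exists (k * a * k^-1 * a^-1); first by apply: IM; [exact: IJ | exact: IV].
move=> u; rewrite !tree_autME [a^-1 _]sectionE.
set w := a^-1 _; set u' := section _ _ _.
have kw : k (w ++ u') = w ++ u'.
  apply: tcomm_off_ray; first by rewrite size_tree_autV size_ypow.
  by apply/eqP => /(congr1 a); rewrite tree_autK => /esym.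
rewrite -{1}kw tree_autVK /w /u' -sectionE tree_autK; exact: tcomm_ray.
Qed.

End NormalSubgroup.

(** * Elementary amenable groups *)

(** The image of [N] under the correspondence is normal in the image of [T].  If
    it is trivial the correspondence factors through [Q]; otherwise its sections
    at a vertex of the ray contain what is needed. *)
Lemma represents_extension (N T Q : groupType)
    (i : {multiplicative N -> T}) (p : {multiplicative T -> Q}) f :
  (forall y, exists x, p x = y) ->
  (forall x, p x = 1 <-> exists n, i n = x) ->
  0 < f -> coprime f q -> represents T f ->
  (exists2 e, 0 < e & represents N e) \/ represents Q f.
Proof.
move=> p_surj ker f0 fq [R [RC [t Rt] [t' Rt']]].
pose I k := exists n, R (i n) k.
have [I1|] := pselect (forall k, I k -> k = 1).
  right; exists (fun s k => exists2 t, p t = s & R t k); split.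
  - split=> [|s s' k k' [r rs Rr] [r' rs' Rr']|s k [r rs Rr]|k [r]|s k [r _]].
    + by exists 1; [exact: multiplicative1 | exact: corr1].
    + by exists (r * r'); [rewrite gmulfM rs rs' | exact: corrM].
    + by exists r^-1; [rewrite multiplicativeV rs | exact: corrV].
    + by move=> /ker[n <-] Rn; apply: I1; exists n.
    + exact: corr_sub.
  - by exists (p t), t.
  - by exists (p t'), t'.
move=> /existsNP[h /not_implyP[Ih /eqP h1]]; left.
have ICorr := corr_preim i RC.
have IM a b : I a -> I b -> I (a * b).
  by move=> [s Rs] [s' Rs']; exists (s * s'); exact: (corrM ICorr).
have IV a : I a -> I a^-1.
  by move=> [s Rs]; exists s^-1; exact: (corrV ICorr).
have IJ k a : (exists s, R s k) -> I a -> I (k * a * k^-1).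
  move=> [s Rs] [n Rn].
  have /ker[n' n'E] : p (s * i n * s^-1) = 1.
    have -> : p (s * i n * s^-1) = p s * p (i n) * (p s)^-1.
      by rewrite !gmulfM multiplicativeV.
    by have -> : p (i n) = 1 by [apply/ker; exists n]; rewrite mulg1 mulgV.
  by exists n'; rewrite n'E; exact: (corrM RC (corrM RC Rs Rn) (corrV RC Rs)).
have Kd l : exists s, R s (d ^+ (f * l)).
  by exists (t ^+ l); rewrite (expgnA d); exact: corrX.
have I1 : I 1 by exists 1; exact: (corr1 ICorr).
have IG a : I a -> a \in G by move=> [n]; exact: corr_sub.
have [n [e [e0 [r [s Rs] rE] [r' [s' Rs'] r'E]]]] :=
  normal_section f0 fq I1 IM IV IG IJ Kd (corr_tcomm RC Rt Rt') Ih h1.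
exists (C * (f * e))%N; first by rewrite !muln_gt0 C0 f0.
have VC := corr_at_vertex (wpow y n) ICorr.
have Vs : at_vertex (fun s k => R (i s) k) (wpow y n) s (d ^+ e) by exists r.
have Vs' : at_vertex (fun s k => R (i s) k) (wpow y n) s' (tcomm (C * (f * e))).
  by exists r'.
have Ve : at_vertex (fun s k => R (i s) k) (wpow y n)
    (s ^+ (C * f)) (d ^+ (C * (f * e))).
  have -> : (C * (f * e) = e * (C * f))%N by rewrite mulnA mulnC.
  by rewrite (expgnA d); exact: (corrX _ VC Vs).
exists (at_vertex (fun s k => R (i s) k) (wpow y n)); split=> //.
  by exists (s ^+ (C * f)).
exists (s' * s ^+ (C * f)).
by rewrite -[twist _](mulgVK (d ^+ (C * (f * e)))); exact: (corrM VC Vs' Ve).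
Qed.

Lemma elementary_amenable_not_represents (T : groupType) :
  elementary_amenable T -> forall e, 0 < e -> ~ represents T e.
Proof.
elim=> {T} [T Tfin|T Tab|H T i i_inj _ IHT|T Q p p_surj _ IHT
  |N T Q i p i_inj p_surj ker _ IHN _ IHQ|dd I D f L phi lim _ IHD] e e0.
- exact: not_represents_finite.
- move=> /(represents_coprime e0)[f [f0 fq]].
  exact: not_represents_abelian.
- move=> [R [RC [t Rt] [t' Rt']]]; apply: (IHT e e0).
  exists (fun s k => exists2 h, s = i h & R h k); split.
  + split.
    * by exists 1; [rewrite multiplicative1 | exact: corr1].
    * move=> s s' k k' [h -> Rh] [h' -> Rh'].
      by exists (h * h'); [rewrite gmulfM | exact: corrM].
    * move=> s k [h -> Rh].
      by exists h^-1; [rewrite multiplicativeV | exact: corrV].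
    * move=> k [h]; rewrite -(multiplicative1 i) => /i_inj <-; exact: corr_fun.
    * by move=> s k [h _]; exact: corr_sub.
  + by exists (i t), t.
  + by exists (i t'), t'.
- move=> [R [RC [t Rt] [t' Rt']]]; apply: (IHT e e0).
  exists (fun s k => R (p s) k); split; first exact: corr_preim.
    by have [s ps] := p_surj t; exists s; rewrite ps.
  by have [s' ps'] := p_surj t'; exists s'; rewrite ps'.
- move=> /(represents_coprime e0)[f [f0 fq]].
  move=> /(represents_extension p_surj ker f0 fq)[[e' e'0]|].
    exact: IHN.
  exact: IHQ.
- move=> [R [RC [t Rt] [t' Rt']]].
  have [a [s sE]] := dl_surj lim t; have [b [s' sE']] := dl_surj lim t'.
  have [k [ak bk]] := dl_directed lim a b.
  have phiE j (jk : (j <= k)%O) z : phi k (f j k jk z) = phi j z.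
    apply/esym/(dl_eq lim); exists k, jk, (Order.PreorderTheory.lexx k).
    by rewrite (dl_id lim).
  apply: (IHD k e e0); exists (fun s k => R (phi _ s) k); split.
  + exact: corr_preim.
  + by exists (f a k ak s); rewrite phiE sE.
  + by exists (f b k bk s'); rewrite phiE sE'.
Qed.

End Obstruction.

Theorem theorem1p13 (X : finType) (cardX : 2 <= #|X|)
    (G : groupClosed (tree_aut X)) :
  bounded_automata_group G ->
  (exists d : tree_aut X, d \in G /\ odometer d) ->
  virtually_abelian (subgroup G) \/ ~ elementary_amenable (subgroup G).
Proof.
move=> GB [d [dG dO]].
have [Gn|] :=
  pselect (forall t, t \in G -> exists n, eventually_commutes d t n).
  by left; exact: (eventually_commutes_virtually_abelian cardX dO GB Gn).
move=> /existsNP[t /not_implyP[tG /forallNP tn]]; right=> Gea.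
have [g [x [gG gd x0 gx]]] := singular_state dO GB tG tn.
have [_ _ /(_ _ gG)[gb _]] := GB.
have [c gdir] := directed_of_bounded gb x0 gx.
have no_rep := elementary_amenable_not_represents cardX dO GB gd x0 gx gdir Gea.
apply: (no_rep 1%N isT).
exists (fun s k => val s = k); split.
- split=> [||||] //.
  + by move=> s s' k k' <- <-; rewrite valM.
  + by move=> s k <-; rewrite multiplicativeV.
  + by move=> s k <-; exact: valP.
- by exists (Subgroup dG); rewrite expg1.
- have tG' : twist d g 1 \in G.
    by rewrite /twist expg1 gpredM ?gpredV // gpredM.
  by exists (Subgroup tG').
Qed.
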